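(* Let $d\geq1$, $L\ge 1$ to be chosen, and fix a width $p\geq d+3$. For each $j\in\{1,\ldots,d\}$ and $k\in\{1,\ldots,p\}$ let $\{B_{jkr}:r\geq1\}$ be a set of basis functions. Let $\sigma:\mathbb{R}\to\mathbb{R}$ be a non-affine Lipschitz continuous function which is continuously differentiable at at least one point, with nonzero derivative at that point. For $L\geq1$, integers $q_{jk}\geq1$, real numbers $c_{jkr}$, vectors $W_k^{(l)}\in\mathbb{R}^p$ ($2\le l\le L$, $1\le k\le p$), output weights $w_k\in\mathbb{R}$ and biases $b_k^{(l)},b\in\mathbb{R}$, define the HDANN1 function on $[0,1]^d$ by $$x_k^{(1)}=\sigma\Big(\sum_{j=1}^d\sum_{r=1}^{q_{jk}}c_{jkr}B_{jkr}(x_j)+b_k^{(1)}\Big),\quad k=1,\ldots,p,$$ $$x_k^{(l)}=\sigma\big({W_k^{(l)}}^{\top}\mathbf{x}^{(l-1)}+b_k^{(l)}\big),\quad k=1,\ldots,p,\ l=2,\ldots,L,$$ where $\mathbf{x}^{(l)}=(x_1^{(l)},\ldots,x_p^{(l)})^\top$, and output $\mathrm{HDANN1}(\mathbf{x})=\sum_{k=1}^p w_kx_k^{(L)}+b$. Then for any continuous $f:[0,1]^d\to\mathbb{R}$ and any $\epsilon>0$ there exist $L\geq1$, $q_{jk}\geq1$, $W_k^{(l)}\in\mathbb{R}^p$, $w_k\in\mathbb{R}$ and $c_{jkr},b_k^{(l)},b\in\mathbb{R}$ such that $$\sup_{\mathbf{x}\in[0,1]^d}|f(\mathbf{x})-\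mathrm{HDANN1}(\mathbf{x})|<\epsilon.$$
   Context: A set $\{B_r:[0,1]\to\mathbb{R}\,|\,r\geq1\}$ of functions is called a set of basis functions if for every continuous $\phi:[0,1]\to\mathbb{R}$ and every $\epsilon>0$ there exist $q\geq1$ and $c_1,\ldots,c_q,c\in\mathbb{R}$ with $\sup_{x\in[0,1]}|\phi(x)-(\sum_{r=1}^q c_rB_r(x)+c)|<\epsilon$. *)

(* Defs.v *)
From HB Require Import structures.
From mathcomp Require Import all_boot all_order all_algebra.
From mathcomp Require Import all_classical all_reals all_analysis.
Set Implicit Arguments. Unset Strict Implicit. Unset Printing Implicit Defensive.
Import Order.TTheory GRing.Theory Num.Theory.
Import numFieldNormedType.Exports.
Local Open Scope classical_set_scope.
Local Open Scope ring_scope.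

Definition sup_dist {R : realType} {T : Type} (A : set T) (f g : T -> R) : \bar R :=
  ereal_sup [set (`|f x - g x|)%:E | x in A].

Definition unit_interval {R : realType} : set R := [set x : R | 0 <= x <= 1].

Definition basis_functions {R : realType} (B : nat -> R -> R) : Prop :=
  forall phi : R -> R, {within (@unit_interval R), continuous phi} ->
  forall eps : R, 0 < eps ->
  exists q : nat, (1 <= q)%N /\ exists (c : nat -> R) (c0 : R),
    (sup_dist unit_interval phi
       (fun x => (\sum_(1 <= r < q.+1) c r * B r x + c0)%R) < eps%:E)%E.

Definition unit_cube {R : realType} (d : nat) : set 'rV[R]_d :=
  [set x | forall j : 'I_d, 0 <= x ord0 j <= 1].

Definition affine_fun {R : realType} (s : R -> R) : Prop :=
  exists a b : R, forall x, s x = a * x + b.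

Definition lipschitz_fun {R : realType} (s : R -> R) : Prop :=
  exists K : R, forall x y, `|s x - s y| <= K * `|x - y|.

Definition C1_at_nonzero_deriv {R : realType} (s : R -> R) : Prop :=
  exists x0 : R,
    (\forall x \near x0, derivable s x 1) /\
    {for x0, continuous (derive1 s)} /\ derive1 s x0 != 0.

(* Hidden layer x^{(m+1)} of the HDANN1 network (layer index m+1). *)
Fixpoint hdann1_layer {R : realType} (d p : nat) (sigma : R -> R)
    (B : 'I_d -> 'I_p -> nat -> R -> R) (q : 'I_d -> 'I_p -> nat)
    (c : 'I_d -> 'I_p -> nat -> R)
    (W : nat -> 'I_p -> 'I_p -> R) (bias : nat -> 'I_p -> R)
    (x : 'rV[R]_d) (m : nat) : 'I_p -> R :=
  match m with
  | 0%N => fun k => sigma (\sum_(j < d) \sum_(1 <= r < (q j k).+1)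
                           c j k r * B j k r (x ord0 j) + bias 1%N k)
  | m'.+1 => fun k => sigma (\sum_(i < p) W m.+1 k i *
                 hdann1_layer sigma B q c W bias x m' i + bias m.+1 k)
  end.

(* HDANN1(x) = sum_k w_k x_k^{(L)} + b ;
   W l k i = i-th entry of W_k^{(l)}, bias l k = b_k^{(l)} *)
Definition HDANN1 {R : realType} (d p : nat) (sigma : R -> R)
    (B : 'I_d -> 'I_p -> nat -> R -> R) (L : nat) (q : 'I_d -> 'I_p -> nat)
    (c : 'I_d -> 'I_p -> nat -> R)
    (W : nat -> 'I_p -> 'I_p -> R) (bias : nat -> 'I_p -> R)
    (w : 'I_p -> R) (b : R) (x : 'rV[R]_d) : R :=
  \sum_(k < p) w k * hdann1_layer sigma B q c W bias x L.-1 k + b.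

(* Main.v *)
Require Import Defs.
From HB Require Import structures.
From mathcomp Require Import all_boot all_order all_algebra.
From mathcomp Require Import all_classical all_reals all_analysis.
From mathcomp Require Import ring lra zify.
Set Implicit Arguments.
Unset Strict Implicit.
Unset Printing Implicit Defensive.
Import Order.TTheory GRing.Theory Num.Theory.
Import numFieldNormedType.Exports.
Local Open Scope classical_set_scope.
Local Open Scope ring_scope.

(* A Lipschitz function that is not affine has nonvanishing finite differences of
   every order. A finite difference of a primitive of sigma is a limit of Riemann
   sums, and differentiating sigma (a t + b), smoothed in this way, with respect to
   a brings out a factor t: iterating, every monomial t^k is a locally uniform limit
   of linear combinations of dilates and translates of sigma, and so is every
   continuous function of one variable. By Stone-Weierstrass the ridge functions
   exp (w.x + b), whose products are again of this form, span a dense subspace of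
   the continuous functions on the cube; hence so do the functions sigma (w.x + b).
   A deep network of width d + 2 evaluates a sum of such terms one term per layer:
   d units carry the coordinates, one computes the current term and one accumulates
   the sum. The carrying units use that (sigma (x0 + h t) - sigma x0) / (h sigma' x0)
   tends to t as h tends to 0. *)

(** * Uniform approximation and closed spans *)

Section UniformApproximation.
Context {R : realType} {T : Type}.
Implicit Types (C : set T) (f g h : T -> R).

Definition close_on C (e : R) f g : Prop := forall x, C x -> `|f x - g x| <= e.

Lemma close_on_sym C e f g : close_on C e f g -> close_on C e g f.
Proof. by move=> fg x Cx; rewrite distrC fg. Qed.

Lemma close_on_trans C e1 e2 f g h :
  close_on C e1 f g -> close_on C e2 g h -> close_on C (e1 + e2) f h.
Proof.
move=> fg gh x Cx; rewrite -(subrKA (g x)) (le_trans (ler_normD _ _)) //.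
by rewrite lerD ?fg ?gh.
Qed.

Lemma sup_dist_leP C e f g :
  (sup_dist C f g <= e%:E)%E <-> close_on C e f g.
Proof.
split=> [fge x Cx|fg].
  by rewrite -lee_fin; apply: le_trans fge; apply: ereal_sup_ubound; exists x.
by apply: ge_ereal_sup => _ [x Cx <-]; rewrite lee_fin fg.
Qed.

Definition closed_subspace C (V : set (T -> R)) : Prop :=
  [/\ V (fun=> 0),
      forall a f g, V f -> V g -> V (fun x => a * f x + g x) &
      forall f, (forall e, 0 < e -> exists2 g, V g & close_on C e f g) -> V f].

Section Theory.
Context {C : set T} {V : set (T -> R)}.
Hypothesis closedV : closed_subspace C V.

Lemma closed_subspace0 : V (fun=> 0).
Proof. by case: closedV. Qed.

Lemma closed_subspace_lin a f g : V f -> V g -> V (fun x => a * f x + g x).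
Proof. by case: closedV => _ + _; apply. Qed.

Lemma closed_subspace_lim f :
  (forall e, 0 < e -> exists2 g, V g & close_on C e f g) -> V f.
Proof. by case: closedV => _ _; apply. Qed.

Lemma closed_subspace_ext g f : {in C, f =1 g} -> V g -> V f.
Proof.
move=> fg Vg; apply: closed_subspace_lim => e e0; exists g => // x Cx.
by rewrite fg ?inE // subrr normr0 ltW.
Qed.

Lemma closed_subspaceZ a f : V f -> V (fun x => a * f x).
Proof.
move=> Vf; apply: closed_subspace_ext (closed_subspace_lin a Vf closed_subspace0).
by move=> x _; rewrite addr0.
Qed.

Lemma closed_subspaceD f g : V f -> V g -> V (fun x => f x + g x).
Proof.
move=> Vf Vg; apply: closed_subspace_ext (closed_subspace_lin 1 Vf Vg).
by move=> x _; rewrite mul1r.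
Qed.

Lemma closed_subspaceB f g : V f -> V g -> V (fun x => f x - g x).
Proof.
move=> Vf Vg; apply: closed_subspace_ext (closed_subspace_lin (-1) Vg Vf).
by move=> x _; rewrite mulN1r addrC.
Qed.

Lemma closed_subspace_sum (J : Type) (r : seq J) (F : J -> T -> R) :
  (forall j, V (F j)) -> V (fun x => \sum_(j <- r) F j x).
Proof.
move=> VF; elim: r => [|j r IHr].
  by apply: closed_subspace_ext closed_subspace0 => x _; rewrite big_nil.
apply: closed_subspace_ext (closed_subspaceD (VF j) IHr) => x _.
by rewrite big_cons.
Qed.

End Theory.

Definition lincomb {I : Type} (G : I -> T -> R) (s : seq (R * I)) : T -> R :=
  fun x => \sum_(u <- s) u.1 * G u.2 x.

Definition cspan {I : Type} C (G : I -> T -> R) : set (T -> R) :=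
  [set f | forall e, 0 < e -> exists s, close_on C e f (lincomb G s)].

Section ClosedSpan.
Context {I : Type} {C : set T} {G : I -> T -> R}.

Lemma cspan_gen i : cspan C G (G i).
Proof.
move=> e e0; exists [:: (1, i)] => x _.
by rewrite /lincomb big_seq1 mul1r subrr normr0 ltW.
Qed.

Lemma cspan_closed : closed_subspace C (cspan C G).
Proof.
split=> [e e0|a f g Vf Vg e e0|f fV e e0].
- by exists [::] => x _; rewrite /lincomb big_nil subrr normr0 ltW.
- have a0 : 0 < `|a| + 1 by rewrite ltr_wpDl.
  have [s fs] := Vf (e / 2 / (`|a| + 1)) (divr_gt0 (divr_gt0 e0 (ltr0n _ 2)) a0).
  have [t gt] := Vg (e / 2) (divr_gt0 e0 (ltr0n _ 2)).
  exists ([seq (a * u.1, u.2) | u <- s] ++ t) => x Cx.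
  have -> : lincomb G ([seq (a * u.1, u.2) | u <- s] ++ t) x =
      a * lincomb G s x + lincomb G t x.
    rewrite /lincomb big_cat big_map /= mulr_sumr; congr (_ + _).
    by apply: eq_bigr => u _; rewrite mulrA.
  rewrite opprD addrACA -mulrBr (le_trans (ler_normD _ _)) // normrM.
  rewrite [leRHS]splitr lerD ?gt // (le_trans (ler_wpM2l _ (fs x Cx))) //.
  by rewrite mulrCA ler_piMr ?divr_ge0 ?(ltW e0) // ler_pdivrMr // mul1r lerDl.
- have e2 : 0 < e / 2 by rewrite divr_gt0.
  have [g Vg fg] := fV _ e2; have [s gs] := Vg _ e2; exists s.
  by rewrite [e]splitr; exact: close_on_trans fg gs.
Qed.

Lemma cspan_min V : closed_subspace C V -> (forall i, V (G i)) -> cspan C G `<=` V.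
Proof.
move=> closedV VG f Gf; apply: (closed_subspace_lim closedV) => e e0.
have [s fs] := Gf e e0; exists (lincomb G s) => //.
apply: (closed_subspace_sum closedV) => u.
exact: (closed_subspaceZ closedV).
Qed.

End ClosedSpan.

End UniformApproximation.

Lemma cspan_comp {R : realType} {T T' I I' : Type} {C : set T} {C' : set T'}
    {G : I -> T -> R} {G' : I' -> T' -> R} (phi : T' -> T) :
  (forall x, C' x -> C (phi x)) -> (forall i, cspan C' G' (G i \o phi)) ->
  cspan C G `<=` [set f : T -> R | cspan C' G' (f \o phi)].
Proof.
move=> CC' GG'; apply: cspan_min => //.
have closedG' := @cspan_closed _ _ _ C' G'.
split=> /= [|a f g|f Vf].
- exact: (closed_subspace0 closedG').
- exact: (closed_subspace_lin closedG' a).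
- apply: (closed_subspace_lim closedG') => e /Vf[g Gg fg].
  by exists (g \o phi) => // x /CC'; exact: fg.
Qed.

(** * The Stone-Weierstrass theorem *)

Section ContinuousFunctions.
Context {R : realType} {T : topologicalType} {C : set T}.
Implicit Types f g : T -> R.

Lemma continuous_closed_subspace :
  closed_subspace C [set f : T -> R | {within C, continuous f}].
Proof.
split=> /= [|a f g|f Vf].
- by move=> x; exact: cvg_cst.
- by move=> cf cg x; apply: cvgD; [apply: cvgM; [exact: cvg_cst|exact: cf]|exact: cg].
- apply/subspace_continuousP => x Cx; apply/cvgrPdist_le => e e0.
  have e3 : 0 < e / 3 by rewrite divr_gt0.
  have [g /subspace_continuousP/(_ x Cx)/cvgrPdist_le/(_ _ e3) cg fg] := Vf _ e3.
  near=> y; have Cy : C y by near: y; exact: withinT.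
  have gxy : `|g x - g y| <= e / 3 by near: y.
  rewrite -(subrKA (g x)) -(subrKA (g y) (g x)) addrA.
  have -> : e = e / 3 + e / 3 + e / 3 by field.
  rewrite (le_trans (ler_normD _ _)) // lerD //; last by rewrite distrC fg.
  by rewrite (le_trans (ler_normD _ _)) // lerD ?fg.
Unshelve. all: by end_near.
Qed.

Lemma cspan_continuous {I : Type} {G : I -> T -> R} :
  (forall i, {within C, continuous (G i)}) ->
  cspan C G `<=` [set f : T -> R | {within C, continuous f}].
Proof. exact: cspan_min continuous_closed_subspace. Qed.

Lemma compact_continuous_bounded f :
  compact C -> {within C, continuous f} -> [bounded f x | x in C].
Proof.
move=> cptC /continuous_compact/(_ cptC)/compact_bounded[M [Mreal fM]].
by exists M; split=> // N MN x Cx; apply: fM MN _ _; exists x.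
Qed.

(* Compactness is applied to the filter of the functions eventually above each
   element of [L], which is proper because [L] is directed. *)
Lemma compact_max_dominates (L : set (T -> R)) f : compact C -> L !=set0 ->
  (forall g h, L g -> L h -> L (g \max h)) ->
  (forall g, L g -> {within C, continuous g}) -> {within C, continuous f} ->
  (forall x, C x -> exists2 g, L g & f x < g x) ->
  exists2 g, L g & forall x, C x -> f x < g x.
Proof.
move=> /compact_near_coveringP cptC [g0 Lg0] Lmax Lc fc fL.
pose above g := [set h | L h /\ forall x, g x <= h x].
have LF : ProperFilter (filter_from L above).
  apply: filter_from_proper => [|g Lg]; last by exists g; split.
  apply: filter_from_filter => [|g h Lg Lh]; first by exists g0.
  exists (g \max h); first exact: Lmax.
  move=> k [Lk ghk].
  by split; split=> // x; have := ghk x; rewrite ge_max => /andP[].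
have [h [Lh fh]] : exists h, L h /\ (C `<=` [set x | C x -> f x < h x]).
  apply: (filter_ex (F := filter_from L above)); apply: filterI.
    by exists g0 => // h [].
  apply: (cptC _ (filter_from L above) (fun h x => C x -> f x < h x)) => x Cx.
  have [g Lg fgx] := fL x Cx.
  have {}fgx : \forall y \near within C (nbhs x), f y < g y.
    have cB : g y - f y @[y --> within C (nbhs x)] --> g x - f x.
      apply: cvgB; first by move: (Lc _ Lg) => /subspace_continuousP; exact.
      by move/subspace_continuousP: fc; exact.
    have /cvgr_gt/(_ 0) := cB; rewrite subr_gt0 => /(_ fgx).
    by apply: filterS => y; rewrite subr_gt0.
  exists ([set y | C y -> f y < g y], above g) => /=.
    by split; [exact: fgx|exists g].
  by move=> [y h] /= [fgy [_ gh]] Cy; exact: lt_le_trans (fgy Cy) (gh y).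
by exists h => // x Cx; exact: fh.
Qed.

End ContinuousFunctions.

Section SquareRoot.
Context {R : realType}.
Implicit Types (s y : R) (n : nat).

Fixpoint sqrt_iter n y : R :=
  if n is m.+1 then sqrt_iter m y + (y - sqrt_iter m y ^+ 2) / 2 else 0.

(* The error is multiplied by [1 - (s + sqrt_iter n (s ^+ 2)) / 2 <= 1 - s / 2]
   at each step. *)
Lemma sqrt_iter_bounds s n : 0 <= s <= 1 ->
  0 <= sqrt_iter n (s ^+ 2) <= s /\ n%:R * (s - sqrt_iter n (s ^+ 2)) <= 2.
Proof.
move=> /andP[s0 s1]; elim: n => [|n [/andP[p0 ps] IHn]] /=.
  by rewrite lexx s0 mul0r.
set p := sqrt_iter n _ in p0 ps IHn *.
have stepE : s - (p + (s ^+ 2 - p ^+ 2) / 2) = (s - p) * (1 - (s + p) / 2).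
  by field.
split; first by apply/andP; split; [|rewrite -subr_ge0 stepE]; nra.
have n0 : 0 <= n%:R :> R by [].
rewrite stepE -natr1 mulrA (@le_trans _ _ ((2 + s) * (1 - s / 2))) //; last nra.
by apply: ler_pM; nra.
Qed.

End SquareRoot.

Section StoneWeierstrass.
Context {R : realType} {T : topologicalType}.
Variables (C : set T) (A : set (T -> R)).
Hypothesis cptC : compact C.
Hypothesis closedA : closed_subspace C A.
Hypothesis A_one : A (fun=> 1).
Hypothesis A_mul : forall f g, A f -> A g -> A (fun x => f x * g x).
Hypothesis A_continuous : forall f, A f -> {within C, continuous f}.
Implicit Types f g : T -> R.

Let A_cst a : A (fun=> a).
Proof. by rewrite -[a]mulr1; exact: (closed_subspaceZ closedA a A_one). Qed.

Let A_sqrt_iter n f : A f -> A (fun x => sqrt_iter n (f x ^+ 2)).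
Proof.
move=> Af; elim: n => [|n IHn] /=; first exact: A_cst.
apply: (closed_subspaceD closedA) => //.
pose p x := sqrt_iter n (f x ^+ 2).
apply: (closed_subspace_ext closedA (g := fun x => 2^-1 * (f x * f x - p x * p x))).
  by move=> x _; rewrite mulrC -!expr2.
by apply/(closed_subspaceZ closedA)/(closed_subspaceB closedA); exact: A_mul.
Qed.

Lemma closed_subalgebra_norm f : A f -> A (fun x => `|f x|).
Proof.
move=> Af; have /ex_strict_bound_gt0[M M0 fM] :=
  compact_continuous_bounded cptC (A_continuous Af).
apply: (closed_subspace_lim closedA) => e e0; pose n := Num.bound (2 * M / e).
have M2e : 2 * M <= n%:R * e.
  rewrite -ler_pdivrMr // ltW //; apply: archi_boundP.
  by rewrite divr_ge0 ?mulr_ge0 ?ltW.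
have n0 : 0 < n%:R :> R.
  by rewrite -(pmulr_lgt0 _ e0) (lt_le_trans _ M2e) // mulr_gt0.
exists (fun x => M * sqrt_iter n ((M^-1 * f x) ^+ 2)).
  by apply/(closed_subspaceZ closedA)/A_sqrt_iter/(closed_subspaceZ closedA).
move=> x Cx; set s := `|M^-1 * f x|.
have sE : `|f x| = M * s.
  by rewrite /s normrM (gtr0_norm (x := M^-1)) ?invr_gt0 // mulVKf ?lt0r_neq0.
have s01 : 0 <= s <= 1.
  by rewrite normr_ge0 -(ler_pM2l M0) mulr1 -sE ltW // fM.
have [/andP[_ ps] err] := sqrt_iter_bounds n s01.
rewrite real_normK ?num_real // in ps err.
rewrite sE -mulrBr normrM (gtr0_norm M0) ger0_norm ?subr_ge0 //.
rewrite -(ler_pM2l n0) mulrCA (le_trans (ler_wpM2l (ltW M0) err)) //.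
by rewrite mulrC.
Qed.

Lemma closed_subalgebra_max f g : A f -> A g -> A (f \max g).
Proof.
move=> Af Ag; have AfDg := closed_subspaceD closedA Af Ag.
have AfBg := closed_subalgebra_norm (closed_subspaceB closedA Af Ag).
have Amax := closed_subspaceZ closedA 2^-1 (closed_subspaceD closedA AfDg AfBg).
by apply: (closed_subspace_ext closedA _ Amax) => x _; rewrite /= maxr_absE mulrC.
Qed.

Hypothesis A_separates : forall x y, C x -> C y -> x != y ->
  exists2 g, A g & g x != g y.

Lemma separating_interpolation f x y : C x -> C y ->
  exists2 g, A g & g x = f x /\ g y = f y.
Proof.
move=> Cx Cy; have [<-|xy] := eqVneq x y.
  by exists (fun=> f x); first exact: A_cst.
have [h Ah hxy] := A_separates Cx Cy xy.
exists (fun z => f x + (f y - f x) / (h y - h x) * (h z - h x)).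
  have AhB := closed_subspaceB closedA Ah (A_cst (h x)).
  exact: (closed_subspaceD closedA (A_cst (f x)) (closed_subspaceZ closedA _ AhB)).
by rewrite subrr mulr0 addr0 divfK ?subr_eq0 1?eq_sym // subrKC.
Qed.

Lemma one_point_upper_approx f x e : {within C, continuous f} -> 0 < e -> C x ->
  exists2 g, A g & g x < f x + e /\ forall y, C y -> f y - e < g y.
Proof.
move=> fc e0 Cx.
have [||||y Cy|g [Ag gx] fg] :=
  compact_max_dominates (L := [set g | A g /\ g x < f x + e])
    (f := fun y => f y - e) cptC.
- by exists (fun=> f x); split; [exact: A_cst|rewrite ltrDl].
- move=> g h [Ag gx] [Ah hx]; split; first exact: closed_subalgebra_max.
  by rewrite gt_max gx.
- by move=> g [/A_continuous].
- by move=> y; apply: cvgB; [exact: fc|exact: cvg_cst].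
- have [g Ag [gx gy]] := separating_interpolation f Cx Cy.
  by exists g; [split; rewrite // gx ltrDl|rewrite gy ltrBlDr ltrDl].
- by exists g.
Qed.

Theorem stone_weierstrass f : {within C, continuous f} -> A f.
Proof.
move=> fc; apply: (closed_subspace_lim closedA) => e e0.
have /ex_strict_bound_gt0[M _ fM] := compact_continuous_bounded cptC fc.
have [||||x Cx|g [Ag gf] fg] :=
  compact_max_dominates (L := [set g | A g /\ forall x, C x -> g x < - f x + e])
    (f := fun x => - f x - e) cptC.
- exists (fun=> - M); split=> [|x Cx]; first exact: A_cst.
  have := fM x Cx; rewrite /= ltr_norml => /andP[_ fxM].
  by rewrite ltr_wpDr ?ltrN2 ?ltW.
- move=> g h [Ag gf] [Ah hf]; split; first exact: closed_subalgebra_max.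
  by move=> x Cx; rewrite gt_max gf ?hf.
- by move=> g [/A_continuous].
- by move=> x; apply: cvgB; [apply: cvgN; exact: fc|exact: cvg_cst].
- have [g Ag [gx gf]] := one_point_upper_approx fc e0 Cx.
  exists (fun y => - 1 * g y); last by rewrite mulN1r -opprD ltrN2.
  split=> [|y Cy]; first exact: (closed_subspaceZ closedA).
  by have := gf y Cy; lra.
- exists (fun x => - 1 * g x); first exact: (closed_subspaceZ closedA).
  move=> x Cx; have := gf x Cx; have := fg x Cx.
  by rewrite mulN1r opprK ler_norml; lra.
Qed.

End StoneWeierstrass.

Section MultiplicativeSpan.
Context {R : realType} {T : topologicalType} {I : Type}.
Variables (C : set T) (G : I -> T -> R).
Hypothesis cptC : compact C.
Hypothesis G_continuous : forall i, {within C, continuous (G i)}.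
Hypothesis G_one : exists i, forall x, G i x = 1.
Hypothesis G_mul : forall i j, exists k, forall x, G k x = G i x * G j x.

Let closedG : closed_subspace C (cspan C G) := cspan_closed.

Let closed_subspace_mul (h : T -> R) : {within C, continuous h} ->
  closed_subspace C [set f : T -> R | cspan C G (fun x => f x * h x)].
Proof.
move=> /(compact_continuous_bounded cptC)/ex_strict_bound_gt0[M M0 hM].
split=> /= [|a f g Gf Gg|f Gf].
- apply: (closed_subspace_ext closedG _ (closed_subspace0 closedG)) => x _.
  by rewrite mul0r.
- apply: (closed_subspace_ext closedG _ (closed_subspace_lin closedG a Gf Gg)) => x _.
  by rewrite mulrDl mulrA.
- apply: (closed_subspace_lim closedG) => e e0.
  have [g Gg fg] := Gf (e / M) (divr_gt0 e0 M0); exists (fun x => g x * h x) => //.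
  move=> x Cx; rewrite -mulrBl normrM -[leRHS](divfK (lt0r_neq0 M0)).
  by rewrite ler_pM ?fg // ltW // hM.
Qed.

Lemma cspan_mul f g : cspan C G f -> cspan C G g -> cspan C G (fun x => f x * g x).
Proof.
move=> Gf Gg; have gc := cspan_continuous G_continuous Gg.
apply: (cspan_min (closed_subspace_mul gc) _ Gf) => i /=.
apply: (closed_subspace_ext closedG (g := fun x => g x * G i x)).
  by move=> x _; exact: mulrC.
apply: (cspan_min (closed_subspace_mul (@G_continuous i)) _ Gg) => j /=.
have [k Gk] := G_mul j i.
by apply: (closed_subspace_ext closedG _ (cspan_gen k)) => x _.
Qed.

Lemma stone_weierstrass_cspan f :
  (forall x y, C x -> C y -> x != y -> exists i, G i x != G i y) ->
  {within C, continuous f} -> cspan C G f.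
Proof.
move=> G_separates; apply: stone_weierstrass => //.
- have [i Gi] := G_one.
  by apply: (closed_subspace_ext closedG _ (cspan_gen i)) => x _.
- exact: cspan_mul.
- exact: cspan_continuous.
- move=> x y Cx Cy /(G_separates x y Cx Cy)[i Gxy].
  by exists (G i) => //; exact: cspan_gen.
Qed.

End MultiplicativeSpan.

(** * Univariate density of the dilates of a Lipschitz function *)

Section FiniteDifferences.
Context {R : realType}.
Implicit Types (g : R -> R) (h t : R).

Definition fdiff h g : R -> R := fun t => g (t + h) - g t.

Lemma lipschitz_fun_ge0 g : lipschitz_fun g ->
  exists2 K, 0 <= K & forall x y, `|g x - g y| <= K * `|x - y|.
Proof.
move=> [K gK]; exists `|K| => // x y; apply: (le_trans (gK x y)).
by rewrite ler_wpM2r // ler_norm.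
Qed.

Lemma lipschitz_fun_continuous g : lipschitz_fun g -> continuous g.
Proof.
move=> /lipschitz_fun_ge0[K K0 gK] x; apply/cvgrPdist_le => e e0.
have K1 : 0 < K + 1 by rewrite ltr_wpDl.
near=> y; rewrite (le_trans (gK x y)) //.
apply: (@le_trans _ _ ((K + 1) * `|x - y|)).
  by rewrite ler_wpM2r // lerDl.
rewrite -ler_pdivlMl //; near: y.
by apply: (@cvgr_dist_le _ _ _ _ _ id); [exact: cvg_id|rewrite mulr_gt0 ?invr_gt0].
Unshelve. all: by end_near.
Qed.

Lemma lipschitz_fun_fdiff h g : lipschitz_fun g -> lipschitz_fun (fdiff h g).
Proof.
move=> [K gK]; exists (K + K) => x y; rewrite /fdiff.
have -> : g (x + h) - g x - (g (y + h) - g y) =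
    g (x + h) - g (y + h) - (g x - g y) by ring.
rewrite mulrDl (le_trans (ler_normB _ _)) // lerD //.
have -> : x - y = x + h - (y + h) by ring.
exact: gK.
Qed.

Lemma lipschitz_fun_iter_fdiff k h g :
  lipschitz_fun g -> lipschitz_fun (iter k (fdiff h) g).
Proof. by move=> gL; elim: k => //= k; exact: lipschitz_fun_fdiff. Qed.

Lemma lipschitz_fun_fdiff_bounded h g : lipschitz_fun g -> bounded_fun (fdiff h g).
Proof.
move=> [K gK]; exists (K * `|h|); split=> [|M KM t _]; first exact: num_real.
by rewrite /= (le_trans (gK _ _)) // addrC addKr ltW.
Qed.

Lemma fdiff_sum h g n t :
  fdiff (n%:R * h) g t = \sum_(i < n) fdiff h g (t + i%:R * h).
Proof.
rewrite -(big_mkord xpredT (fun i => fdiff h g (t + i%:R * h))).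
rewrite (telescope_sumr_eq (fun i => g (t + i%:R * h))) ?mul0r ?addr0 // => i _.
by rewrite /fdiff -natr1 mulrDl mul1r addrA.
Qed.

Lemma natmul_bounded_eq0 (x A : R) : (forall n, n%:R * `|x| <= A) -> x = 0.
Proof.
move=> xA; apply/eqP; rewrite -normr_le0 leNgt; apply/negP => x0.
have A0 : 0 <= A by have := xA 0%N; rewrite mul0r.
have := archi_boundP (divr_ge0 A0 (ltW x0)).
by rewrite ltr_pdivrMr // ltNge xA.
Qed.

Lemma bounded_fdiff2_eq0 h g : bounded_fun g ->
  (forall t, iter 2 (fdiff h) g t = 0) -> forall t, fdiff h g t = 0.
Proof.
move=> /ex_strict_bound_gt0[A _ gA] g2 t; apply: (@natmul_bounded_eq0 _ (A + A)) => n.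
have fdiff_const i : fdiff h g (t + i%:R * h) = fdiff h g t.
  elim: i => [|i IHi]; first by rewrite mul0r addr0.
  rewrite -natr1 mulrDl mul1r addrA -IHi; apply/eqP.
  by rewrite -subr_eq0; apply/eqP/g2.
rewrite -{1}[n%:R]normr_nat -normrM.
have <- : fdiff (n%:R * h) g t = n%:R * fdiff h g t.
  rewrite fdiff_sum; under eq_bigr do rewrite fdiff_const.
  by rewrite sumr_const card_ord mulr_natl.
by rewrite (le_trans (ler_normB _ _)) // lerD // ltW // gA.
Qed.

Lemma lipschitz_additive_linear (D : {additive R -> R}) :
  lipschitz_fun D -> forall x, D x = x * D 1.
Proof.
move=> /lipschitz_fun_ge0[K K0 DK] x; apply/eqP; rewrite -subr_eq0; apply/eqP.
apply: (@natmul_bounded_eq0 _ (K + `|D 1|)) => n.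
pose m := Num.floor (n%:R * x).
have frac : `|n%:R * x - m%:~R| <= 1.
  have /andP[mx xm] := floor_itv (n%:R * x).
  rewrite ger0_norm ?subr_ge0 // lerBlDl ltW // -/m.
  by move: xm; rewrite intrD.
have Dn : D (n%:R * x) = n%:R * D x by rewrite !mulr_natl raddfMn.
have Dm : D m%:~R = m%:~R * D 1 by rewrite raddfMz mulrzl.
rewrite -{1}[n%:R]normr_nat -normrM mulrBr.
have -> : n%:R * D x - n%:R * (x * D 1) =
    (D (n%:R * x) - D m%:~R) - (n%:R * x - m%:~R) * D 1.
  by rewrite Dn Dm; ring.
rewrite (le_trans (ler_normB _ _)) // lerD //.
  by rewrite (le_trans (DK _ _)) // ler_piMr.
by rewrite normrM ler_piMl.
Qed.

Lemma fdiff2_eq0_affine g : lipschitz_fun g ->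
  (forall h t, iter 2 (fdiff h) g t = 0) -> affine_fun g.
Proof.
move=> [K gK] g2; pose D x := g x - g 0.
have jensen s t : g s + g t = 2 * g ((s + t) / 2).
  have := g2 ((t - s) / 2) s; rewrite /= /fdiff.
  have -> : s + (t - s) / 2 = (s + t) / 2 by field.
  have -> : (s + t) / 2 + (t - s) / 2 = t by field.
  lra.
have D_additive : zmod_morphism D.
  move=> x y; rewrite /D; have := jensen (x - y) y; rewrite subrK.
  have := jensen x 0; rewrite addr0; lra.
pose addD := GRing.isZmodMorphism.Build R R D D_additive.
pose Da : {additive R -> R} := HB.pack D addD.
have D_lipschitz : lipschitz_fun Da.
  exists K => x y; have -> : Da x - Da y = g x - g y by rewrite /= /D; ring.
  exact: gK.
exists (D 1), (g 0) => x.
by rewrite mulrC -[D 1]/(Da 1) -lipschitz_additive_linear //= /D subrK.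
Qed.

Lemma iter_fdiff_neq0 k g : lipschitz_fun g -> ~ affine_fun g ->
  exists h t, iter k (fdiff h) g t != 0.
Proof.
move=> gL g_naff; apply: contrapT => gk; apply: g_naff.
have {}gk h t : iter k (fdiff h) g t = 0.
  by apply: contrapT => /eqP gkt; apply: gk; exists h, t.
apply: fdiff2_eq0_affine => // h; have {gk} : forall t, iter k.+2 (fdiff h) g t = 0.
  by move=> t; rewrite /= /fdiff !gk !subrr.
elim: k => // k IHk fdiff_eq0; apply: IHk; apply: bounded_fdiff2_eq0 fdiff_eq0.
exact: lipschitz_fun_fdiff_bounded (lipschitz_fun_iter_fdiff k h gL).
Qed.

End FiniteDifferences.

Section Primitive.
Context {R : realType}.
Implicit Types g P : R -> R.
Local Notation mu := (@lebesgue_measure R).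

Lemma continuous_primitive g : continuous g ->
  exists P, forall x : R, is_derive x 1 P (g x).
Proof.
move=> cg.
have int_g a b : mu.-integrable `[a, b] (EFin \o g).
  apply: continuous_compact_integrable; first exact: segment_compact.
  exact: continuous_subspaceT.
pose integral_from (a x : R) : R := (\int[mu]_(t in `[a, x]) g t)%R.
pose P (x : R) : R := (if 0 <= x then \int[mu]_(t in `]0%R, x]) g t
                       else - \int[mu]_(t in `]x, 0%R]) g t)%R.
have PE (a x : R) : a <= x -> a <= 0 -> P x = integral_from a x - integral_from a 0.
  move=> ax a0; rewrite /P /integral_from; case: (leP 0 x) => x0.
    by rewrite Rintegral_itvB ?bnd_simp.
  by rewrite -(Rintegral_itvB (int_g a 0) _ (ltW x0)) ?bnd_simp // opprB.
exists P => x; pose a : R := - `|x| - 1.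
have [ax a0] : a < x /\ a <= 0.
  by have := ler_norm (- x); have := normr_ge0 x; rewrite normrN /a; lra.
have x1 : x < x + 1 by rewrite ltrDl.
have [dintegral integralE] := continuous_FTC1_closed x1 (int_g a (x + 1)) ax (cg x).
have dP : is_derive x 1 (fun y => integral_from a y - integral_from a 0) (g x).
  rewrite -[g x]subr0 -integralE derive1E.
  by apply: is_deriveB; exact: derivableP.
apply: near_eq_is_derive dP.
near=> y; rewrite (PE a) //; near: y; exact: lt_le_nbhsr ax.
Unshelve. all: by end_near.
Qed.

Lemma primitive_expansion g P (K u v : R) :
  (forall x : R, is_derive x 1 P (g x)) -> 0 <= K ->
  (forall x y, `|g x - g y| <= K * `|x - y|) ->
  `|P (u + v) - P u - v * g u| <= K * v ^+ 2.
Proof.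
move=> dP K0 gK.
have P_continuous A : {within A, continuous P}.
  apply: continuous_subspaceT => x; have [dPx _] := dP x.
  exact/differentiable_continuous/derivable1_diffP.
have [z zuv ->] : exists2 z, `|z - u| <= `|v| & P (u + v) - P u = g z * v.
  have [v0|v0] := leP 0 v.
    have uv : u <= u + v by rewrite lerDl.
    have [z] := MVT_segment uv (fun x _ => dP x) (P_continuous _).
    rewrite in_itv /= => /andP[uz zuv] ->; exists z; last by rewrite addrC addKr.
    by rewrite !ger0_norm ?subr_ge0 // lerBlDl.
  have uv : u + v <= u by rewrite gerDl ltW.
  have [z] := MVT_segment uv (fun x _ => dP x) (P_continuous _).
  rewrite in_itv /= => /andP[uvz zu] PE; exists z.
    rewrite distrC (ltr0_norm v0) ger0_norm ?subr_ge0 //; lra.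
  by rewrite -opprB PE; ring.
have -> : g z * v - v * g u = (g z - g u) * v by ring.
rewrite normrM -[v ^+ 2]real_normK ?num_real // expr2 mulrA ler_wpM2r //.
by rewrite (le_trans (gK _ _)) // ler_wpM2l.
Qed.

End Primitive.

Section RaisingPowers.
Context {R : realType}.
Variables (C : set R) (V : set (R -> R)).
Hypothesis cptC : compact C.
Hypothesis closedV : closed_subspace C V.
Implicit Types w g : R -> R.

Definition weighted_dilates w g : Prop :=
  forall a b, V (fun t => w t * g (a * t + b)).

Lemma weighted_dilates_fdiff_primitive w g P h :
  {within C, continuous w} -> lipschitz_fun g ->
  (forall x : R, is_derive x 1 P (g x)) ->
  weighted_dilates w g -> weighted_dilates w (fdiff h P).
Proof.
move=> /(compact_continuous_bounded cptC)/ex_strict_bound_gt0[N N0 wN].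
move=> /lipschitz_fun_ge0[K K0 gK] dP Vg a b.
apply: (closed_subspace_lim closedV) => e e0.
pose n := (Num.bound (N * (K * h ^+ 2) / e)).+1; pose d := h / n%:R.
have n0 : n%:R != 0 :> R by rewrite pnatr_eq0.
have hE : h = n%:R * d by rewrite mulrC divfK.
pose riemann u := \sum_(i < n) d * g (u + i%:R * d).
exists (fun t => w t * riemann (a * t + b)).
  have Vi i := closed_subspaceZ closedV d (Vg a (b + i%:R * d)).
  have := closed_subspace_sum closedV (index_enum 'I_n) Vi.
  apply: (closed_subspace_ext closedV) => t _.
  rewrite mulr_sumr; apply: eq_bigr => i _.
  by rewrite mulrCA addrA.
move=> t Ct; rewrite -mulrBr normrM; set u := a * t + b.
have riemann_error : `|fdiff h P u - riemann u| <= K * h ^+ 2 / n%:R.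
  rewrite [in fdiff h]hE fdiff_sum -sumrB (le_trans (ler_norm_sum _ _ _)) //.
  have -> : K * h ^+ 2 / n%:R = \sum_(i < n) K * d ^+ 2.
    by rewrite sumr_const card_ord -mulr_natl /d; field.
  by apply: ler_sum => i _; exact: (primitive_expansion _ d dP K0 gK).
rewrite (le_trans (ler_pM _ _ (ltW (wN t Ct)) riemann_error)) // mulrA.
rewrite ler_pdivrMr ?ltr0n // [e * _]mulrC -ler_pdivrMr // ltW //.
have bound_ge0 : 0 <= N * (K * h ^+ 2) / e.
  by rewrite divr_ge0 ?(ltW e0) // mulr_ge0 ?(ltW N0) // mulr_ge0 ?sqr_ge0.
by rewrite (lt_trans (archi_boundP bound_ge0)) // ltr_nat.
Qed.

(* [w t * t * F' (a * t + b)] is the derivative of [w t * F (a * t + b)] in [a]. *)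
Lemma weighted_dilates_derive w F F' (K : R) :
  {within C, continuous w} -> 0 <= K ->
  (forall u v, `|F (u + v) - F u - v * F' u| <= K * v ^+ 2) ->
  weighted_dilates w F -> weighted_dilates (fun t => w t * t) F'.
Proof.
move=> /(compact_continuous_bounded cptC)/ex_strict_bound_gt0[N N0 wN] K0 FF' VF a b.
have /ex_strict_bound_gt0[M M0 CM] : [bounded t | t in C] by exact: compact_bounded.
apply: (closed_subspace_lim closedV) => e e0.
pose B := N * (K * M ^+ 2); pose eta := e / (B + 1).
have B0 : 0 <= B by rewrite mulr_ge0 ?(ltW N0) // mulr_ge0 ?sqr_ge0.
have eta0 : 0 < eta by rewrite divr_gt0 // ltr_wpDl.
exists (fun t => eta^-1 * (w t * F ((a + eta) * t + b) - w t * F (a * t + b))).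
  by apply/(closed_subspaceZ closedV)/(closed_subspaceB closedV); exact: VF.
move=> t Ct; set u := a * t + b.
have -> : (a + eta) * t + b = u + eta * t by rewrite /u; ring.
have -> : w t * t * F' u - eta^-1 * (w t * F (u + eta * t) - w t * F u) =
    - (eta^-1 * (w t * (F (u + eta * t) - F u - eta * t * F' u))).
  by field; rewrite lt0r_neq0.
rewrite normrN normrM gtr0_norm ?invr_gt0 // ler_pdivrMl // normrM.
have expansion : `|F (u + eta * t) - F u - eta * t * F' u| <=
    eta ^+ 2 * (K * M ^+ 2).
  rewrite (le_trans (FF' _ _)) // exprMn mulrCA ler_wpM2l ?sqr_ge0 //.
  rewrite ler_wpM2l // -[t ^+ 2]real_normK ?num_real // lerXn2r ?nnegrE ?(ltW M0) //.
  by rewrite ltW // CM.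
rewrite (le_trans (ler_pM _ _ (ltW (wN t Ct)) expansion)) // mulrCA expr2 -mulrA.
rewrite ler_pM2l // -/B /eta mulrAC ler_pdivrMr ?ltr_wpDl //.
by rewrite ler_pM2l // lerDl.
Qed.

Lemma weighted_dilates_fdiff w g h : {within C, continuous w} -> lipschitz_fun g ->
  weighted_dilates w g -> weighted_dilates (fun t => w t * t) (fdiff h g).
Proof.
move=> wc gL Vg; have [P dP] := continuous_primitive (lipschitz_fun_continuous gL).
have [K K0 fdiffK] := lipschitz_fun_ge0 (lipschitz_fun_fdiff h gL).
have dfdiff (x : R) : is_derive x 1 (fdiff h P) (fdiff h g x).
  have dshift : is_derive x 1 (P \o shift h) (g (x + h)).
    rewrite -[g _]mulr1.
    exact: (is_derive1_comp (g := shift h) (dP (x + h)) (is_derive_shift x 1 h)).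
  exact: (is_deriveB dshift (dP x)).
apply: (weighted_dilates_derive wc K0 _
  (weighted_dilates_fdiff_primitive h wc gL dP Vg)) => u v.
exact: (primitive_expansion _ _ dfdiff K0 fdiffK).
Qed.

Lemma weighted_dilates_iter_fdiff g h k : lipschitz_fun g ->
  weighted_dilates (fun=> 1) g ->
  weighted_dilates (fun t => t ^+ k) (iter k (fdiff h) g).
Proof.
move=> gL Vg; elim: k => [|k IHk] a b.
  by apply: (closed_subspace_ext closedV _ (Vg a b)) => t _; rewrite expr0.
have Xk : {within C, continuous (fun t => t ^+ k)}.
  by apply: continuous_subspaceT; exact: exprn_continuous.
have := weighted_dilates_fdiff h Xk (lipschitz_fun_iter_fdiff k h gL) IHk a b.
by apply: (closed_subspace_ext closedV) => t _; rewrite exprSr.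
Qed.

End RaisingPowers.

Definition aff {R : realType} (u : R * R) (t : R) : R := u.1 * t + u.2.

Definition dilates {R : realType} (s : R -> R) (u : R * R) : R -> R := s \o aff u.

Section UnivariateDensity.
Context {R : realType} {C : set R} {s : R -> R}.
Hypothesis cptC : compact C.
Hypothesis s_lipschitz : lipschitz_fun s.
Hypothesis s_nonaffine : ~ affine_fun s.

Lemma cspan_dilates_exprn k : cspan C (dilates s) (fun t => t ^+ k).
Proof.
have [h [t0 fdiff_neq0]] := iter_fdiff_neq0 k s_lipschitz s_nonaffine.
have closedG := @cspan_closed _ _ _ C (dilates s).
have Vs : weighted_dilates (cspan C (dilates s)) (fun=> 1) s.
  move=> a b; apply: (closed_subspace_ext closedG _ (cspan_gen (a, b))) => t _.
  by rewrite mul1r.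
have VXk := weighted_dilates_iter_fdiff cptC closedG h k s_lipschitz Vs 0 t0.
have := closed_subspaceZ closedG (iter k (fdiff h) s t0)^-1 VXk.
apply: (closed_subspace_ext closedG) => t _.
by rewrite mul0r add0r mulrCA mulVf ?mulr1.
Qed.

Lemma cspan_exprn_continuous (f : R -> R) : {within C, continuous f} ->
  cspan C (fun (k : nat) (t : R) => t ^+ k) f.
Proof.
apply: stone_weierstrass_cspan => // [k||i j|x y _ _ xy].
- by apply: continuous_subspaceT; exact: exprn_continuous.
- by exists 0%N => t; rewrite expr0.
- by exists (i + j)%N => t; rewrite exprD.
- by exists 1%N.
Qed.

Theorem cspan_dilates_continuous (f : R -> R) :
  {within C, continuous f} -> cspan C (dilates s) f.
Proof.
move=> /cspan_exprn_continuous Xf.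
exact: (cspan_min cspan_closed cspan_dilates_exprn Xf).
Qed.

End UnivariateDensity.

(** * Ridge functions *)

Section AffineCombinations.
Context {R : realType} {T : Type} {I : finType}.
Implicit Types (F : I -> T -> R) (f g : T -> R).

Definition affine_comb F (u : (I -> R) * R) : T -> R :=
  fun x => \sum_i u.1 i * F i x + u.2.

Definition affine_span F : set (T -> R) := range (affine_comb F).

Lemma affine_span_cst F a : affine_span F (fun=> a).
Proof.
exists (fun=> 0, a) => //; apply/funext => x.
by rewrite /affine_comb big1 ?add0r // => i _; rewrite mul0r.
Qed.

Lemma affine_span_gen F i : affine_span F (F i).
Proof.
exists (fun j => (j == i)%:R, 0) => //; apply/funext => x.
rewrite /affine_comb (bigD1 i) //= eqxx mul1r big1 ?addr0 // => j /negPf ->.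
by rewrite mul0r.
Qed.

Lemma affine_span_lin F a f g :
  affine_span F f -> affine_span F g -> affine_span F (fun x => a * f x + g x).
Proof.
move=> [u _ <-] [v _ <-].
exists (fun i => a * u.1 i + v.1 i, a * u.2 + v.2) => //; apply/funext => x.
rewrite /affine_comb /= mulrDr addrACA; congr (_ + _).
by rewrite mulr_sumr -big_split; apply: eq_bigr => i _; rewrite mulrDl mulrA.
Qed.

Lemma affine_comb_aff F (v : I -> R * R) u :
  affine_comb (fun i => aff (v i) \o F i) u =
  affine_comb F (fun i => u.1 i * (v i).1, \sum_i u.1 i * (v i).2 + u.2).
Proof.
apply/funext => x; rewrite /affine_comb /= addrA -big_split /=; congr (_ + _).
by apply: eq_bigr => i _; rewrite /aff mulrDr mulrA.
Qed.

Lemma aff_affine_comb F (v : R * R) u :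
  aff v \o affine_comb F u = affine_comb F (fun i => v.1 * u.1 i, v.1 * u.2 + v.2).
Proof.
apply/funext => x; rewrite /affine_comb /= /aff mulrDr addrA mulr_sumr.
by congr (_ + _ + _); apply: eq_bigr => i _; rewrite mulrA.
Qed.

Lemma affine_comb_close F G u (e : R) (C : set T) : 0 <= e ->
  (forall i, close_on C e (F i) (G i)) ->
  close_on C ((\sum_i `|u.1 i| + 1) * e) (affine_comb F u) (affine_comb G u).
Proof.
move=> e0 FG x Cx; rewrite /affine_comb opprD addrACA subrr addr0 -sumrB.
rewrite (le_trans (ler_norm_sum _ _ _)) // mulrDl mul1r mulr_suml ler_wpDr //.
by apply: ler_sum => i _; rewrite -mulrBr normrM ler_wpM2l ?FG.
Qed.

Lemma affine_comb_bounded F u (C : set T) :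
  (forall i, [bounded F i x | x in C]) -> [bounded affine_comb F u x | x in C].
Proof.
move=> F_bounded.
have /choice[M FM] : forall i, exists M, forall x, C x -> `|F i x| < M.
  by move=> i; have [M _ ?] := ex_strict_bound_gt0 (F_bounded i); exists M.
exists (\sum_i `|u.1 i| * M i + `|u.2|); split=> [|N MN x Cx]; first exact: num_real.
rewrite /= (le_trans _ (ltW MN)) // (le_trans (ler_normD _ _)) // lerD2r.
rewrite (le_trans (ler_norm_sum _ _ _)) //.
by apply: ler_sum => i _; rewrite normrM ler_wpM2l // ltW // FM.
Qed.

End AffineCombinations.

Lemma affine_span_comb {R : realType} {T : Type} {I J : finType}
    (F : I -> T -> R) (G : J -> T -> R) u :
  (forall j, affine_span F (G j)) -> affine_span F (affine_comb G u).
Proof.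
move=> FG; rewrite /affine_comb; elim: (index_enum J) => [|j r IHr].
  by under eq_fun do rewrite big_nil add0r; exact: affine_span_cst.
under eq_fun do rewrite big_cons -addrA.
exact: affine_span_lin.
Qed.

Lemma affine_comb_within_continuous {R : realType} {T : topologicalType}
    {I : finType} {C : set T} (F : I -> T -> R) u :
  (forall i, {within C, continuous (F i)}) ->
  {within C, continuous (affine_comb F u)}.
Proof.
have closedC := @continuous_closed_subspace R T C.
move=> Fc; apply: (closed_subspaceD closedC) => /= [|x]; last exact: cvg_cst.
by apply: (closed_subspace_sum closedC) => i; exact: (closed_subspaceZ closedC).
Qed.

Section Ridge.
Context {R : realType} {d : nat}.
Implicit Types (x : 'rV[R]_d) (f : 'rV[R]_d -> R) (s : R -> R).

Definition coord (j : 'I_d) : 'rV[R]_d -> R := fun x => x ord0 j.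

Definition ridge s (u : ('I_d -> R) * R) : 'rV[R]_d -> R :=
  s \o affine_comb coord u.

Variable C : set 'rV[R]_d.

Lemma coord_within_continuous j : {within C, continuous (coord j)}.
Proof. by apply: continuous_subspaceT; exact: coord_continuous. Qed.

Lemma ridge_within_continuous s u :
  continuous s -> {within C, continuous (ridge s u)}.
Proof.
have comb_continuous : {within C, continuous (affine_comb coord u)}.
  exact: (affine_comb_within_continuous coord_within_continuous).
by move=> cs x; exact: (continuous_comp (comb_continuous x) (cs _)).
Qed.

Hypothesis cptC : compact C.

Lemma cspan_ridge_expR f : {within C, continuous f} -> cspan C (ridge expR) f.
Proof.
apply: stone_weierstrass_cspan => // [u||u v|x y _ _ xy].
- by apply: ridge_within_continuous; exact: continuous_expR.
- exists (fun=> 0, 0) => x; rewrite /ridge /= /affine_comb.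
  by rewrite big1 ?addr0 ?expR0 // => j _; rewrite mul0r.
- exists (fun j => u.1 j + v.1 j, u.2 + v.2) => x.
  rewrite /ridge /= /affine_comb -expRD /= addrACA -big_split; congr (expR (_ + _)).
  by apply: eq_bigr => j _; rewrite mulrDl.
- have /existsNP[j xyj] : ~ forall j, x ord0 j = y ord0 j.
    by move=> xyE; case/eqP: xy; apply/rowP.
  have [u _ uE] := affine_span_gen coord j; exists u.
  by rewrite /ridge uE; apply/eqP => /expR_inj.
Qed.

Theorem cspan_ridge_continuous s f : lipschitz_fun s -> ~ affine_fun s ->
  {within C, continuous f} -> cspan C (ridge s) f.
Proof.
move=> sL s_naff /cspan_ridge_expR; apply: (cspan_min cspan_closed) => u.
have cpt_im : compact (affine_comb coord u @` C).
  apply: continuous_compact cptC.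
  exact: (affine_comb_within_continuous coord_within_continuous).
have exp_dilates : cspan (affine_comb coord u @` C) (dilates s) expR.
  apply: cspan_dilates_continuous => //.
  by apply/continuous_subspaceT; exact: continuous_expR.
apply: (cspan_comp _ _ exp_dilates) => [x Cx|[a b]]; first by exists x.
apply: (closed_subspace_ext cspan_closed _
  (cspan_gen (fun j => a * u.1 j, a * u.2 + b))) => x _.
by rewrite /= /ridge -(aff_affine_comb coord (a, b)).
Qed.

End Ridge.

(** * Functions computed by one unit *)

Section Units.
Context {R : realType}.
Implicit Types (s Phi : R -> R) (pre post : R * R).

Definition unit_computable s Phi : Prop := forall M e : R, 0 < e ->
  exists pre post, close_on [set t | `|t| <= M] e (aff post \o dilates s pre) Phi.

Lemma unit_computable_self s : unit_computable s s.
Proof.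
move=> M e e0; exists (1, 0), (1, 0) => t _.
by rewrite /dilates /= /aff /= !mul1r !addr0 subrr normr0 ltW.
Qed.

Lemma derivable_expansion s (x e : R) : derivable s x 1 -> 0 < e ->
  exists2 r, 0 < r & forall h, `|h| < r ->
    `|s (h + x) - s x - h * s^`()%classic x| <= e * `|h|.
Proof.
move=> ds e0; rewrite derive1E.
move/cvgrPdist_le: ds => /(_ e e0)[r /= r0 quotient_close].
exists r => // h hr; have [->|h0] := eqVneq h 0.
  by rewrite add0r mul0r subr0 subrr !normr0 mulr0.
have := quotient_close h _ h0; rewrite /= sub0r normrN => /(_ hr).
rewrite /GRing.scale /= mulr1 => quotient_error.
have -> : s (h + x) - s x - h * 'D_1 s x =
    - (('D_1 s x - h^-1 * (s (h + x) - s x)) * h) by field.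
by rewrite normrN normrM ler_wpM2r.
Qed.

Lemma unit_computable_id s (x : R) :
  derivable s x 1 -> s^`()%classic x != 0 -> unit_computable s id.
Proof.
move=> ds; set D := s^`()%classic x => D0 M e e0.
have M0 : 0 < `|M| + 1 by rewrite ltr_wpDl.
have tol0 : 0 < e * `|D| / (`|M| + 1) by rewrite !mulr_gt0 ?normr_gt0 // invr_gt0.
have [r r0 expansion] := derivable_expansion ds tol0.
have [a a0 aM] : exists2 a, 0 < a & a * (`|M| + 1) < r.
  exists (r / (2 * (`|M| + 1))); first by rewrite divr_gt0 // mulr_gt0.
  by rewrite invfM mulrA divfK ?lt0r_neq0 // ltr_pdivrMr // ltr_pMr // ltr1n.
exists (a, x), ((a * D)^-1, - (s x / (a * D))) => t tM; rewrite /dilates /= /aff /=.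
have {}tM : `|t| <= `|M| + 1.
  by rewrite (le_trans tM) // (le_trans (ler_norm M)) // lerDl.
have at_lt : `|a * t| < r.
  by rewrite normrM (gtr0_norm a0) (le_lt_trans _ aM) // ler_pM2l.
have -> : (a * D)^-1 * s (a * t + x) - s x / (a * D) - t =
    (a * D)^-1 * (s (a * t + x) - s x - a * t * D).
  by field; rewrite D0 lt0r_neq0.
rewrite normrM normfV ler_pdivrMl ?normr_gt0 ?mulf_neq0 ?(lt0r_neq0 a0) //.
rewrite (le_trans (expansion _ at_lt)) // (normrM a t) (normrM a D) (gtr0_norm a0).
have -> : e * `|D| / (`|M| + 1) * (a * `|t|) =
    a * `|D| * e * (`|t| / (`|M| + 1)) by ring.
by rewrite ler_piMr ?ler_pdivrMr ?mul1r // !mulr_ge0 // ltW.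
Qed.

Lemma unit_computable_robust s Phi (M e : R) :
  lipschitz_fun s -> unit_computable s Phi -> 0 < e ->
  exists pre post (r : R), 0 < r /\ forall t t', `|t| <= M -> `|t' - t| <= r ->
    `|aff post (s (aff pre t')) - Phi t| <= e.
Proof.
move=> /lipschitz_fun_ge0[K K0 sK] sPhi e0.
have e2 : 0 < e / 2 by rewrite divr_gt0.
have [pre [post unit_close]] := sPhi M _ e2; exists pre, post.
pose L := `|post.1| * (K * `|pre.1|); have L0 : 0 <= L by rewrite !mulr_ge0.
exists (e / 2 / (L + 1)); split; first by rewrite divr_gt0 // ltr_wpDl.
move=> t t' tM tt'; rewrite -(subrKA (aff post (s (aff pre t)))).
rewrite (le_trans (ler_normD _ _)) // [leRHS]splitr lerD ?unit_close //.
have -> : aff post (s (aff pre t')) - aff post (s (aff pre t)) =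
    post.1 * (s (aff pre t') - s (aff pre t)) by rewrite /aff; ring.
have aff_diff : aff pre t' - aff pre t = pre.1 * (t' - t) by rewrite /aff; ring.
rewrite normrM (@le_trans _ _ (L * `|t' - t|)) //.
  rewrite /L -!mulrA ler_wpM2l // -normrM -aff_diff; exact: sK.
rewrite (le_trans (ler_wpM2l L0 tt')) // mulrCA ler_piMr ?(ltW e2) //.
by rewrite ler_pdivrMr ?ltr_wpDl // mul1r lerDl.
Qed.

Context {T : Type} {I : finType} (s : R -> R).
Implicit Types (F : I -> T -> R) (g : T -> R).

Definition unit_over F g : Prop := exists2 Phi, unit_computable s Phi &
  exists2 v, affine_span F v & g = Phi \o v.

Lemma unit_over_affine F g :
  unit_computable s id -> affine_span F g -> unit_over F g.
Proof. by move=> s_id Fg; exists id => //; exists g. Qed.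

Lemma unit_over_robust F g (C : set T) (e : R) : lipschitz_fun s ->
  (forall i, [bounded F i x | x in C]) ->
  unit_over F g -> 0 < e ->
  exists v post (r : R), 0 < r /\ forall F' : I -> T -> R,
    (forall i, close_on C r (F' i) (F i)) ->
    close_on C e (aff post \o s \o affine_comb F' v) g.
Proof.
move=> sL F_bounded [Phi sPhi [_ [u _ <-] ->]] e0.
have /ex_strict_bound_gt0[M _ uM] := affine_comb_bounded u F_bounded.
have [pre [post [r [r0 robust]]]] := unit_computable_robust M sL sPhi e0.
have sum_gt0 : 0 < \sum_i `|u.1 i| + 1 by rewrite ltr_wpDl // sumr_ge0.
exists (fun i => pre.1 * u.1 i, pre.1 * u.2 + pre.2), post.
exists (r / (\sum_i `|u.1 i| + 1)).
split=> [|F' F'F x Cx]; first by rewrite divr_gt0.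
rewrite -(aff_affine_comb F' pre); apply: robust; first exact/ltW/uM.
have := affine_comb_close u (ltW (divr_gt0 r0 sum_gt0)) F'F Cx.
by rewrite mulrC divfK ?lt0r_neq0.
Qed.

End Units.

(** * Emulating a ridge combination by a deep narrow network *)

Lemma unit_cube_compact {R : realType} {d : nat} : compact (@unit_cube R d).
Proof.
have -> : @unit_cube R d = [set x | forall j, `[0, 1]%classic (x ord0 j)].
  by apply/seteqP; split=> x Cx j; have := Cx j; rewrite /= in_itv.
apply: (@rV_compact _ _ (fun=> `[(0 : R), 1]%classic)) => _.
exact: segment_compact.
Qed.

Section Emulation.
Context {R : realType} {d p : nat}.
Variables (B : 'I_d -> 'I_p -> nat -> R -> R) (s : R -> R).
Hypothesis B_basis : forall j k, basis_functions (B j k).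
Hypothesis s_lipschitz : lipschitz_fun s.
Implicit Types (F G : 'I_p -> 'rV[R]_d -> R) (m : nat).
Local Notation cube := (@unit_cube R d).

Lemma basis_functions_id j k (e : R) : 0 < e -> exists q c (c0 : R), (1 <= q)%N /\
  close_on unit_interval e (fun t => \sum_(1 <= r < q.+1) c r * B j k r t + c0) id.
Proof.
move=> e0; have id_continuous : {within @unit_interval R, continuous id}.
  by apply: continuous_subspaceT => ? ?.
have [q [q1 [c [c0 /ltW/sup_dist_leP id_close]]]] := B_basis j k id_continuous e0.
by exists q, c, c0; split=> //; exact: close_on_sym.
Qed.

Lemma eq_hdann1_layer q c W W' bias bias' x m :
  (forall l, (l <= m.+1)%N -> W l = W' l /\ bias l = bias' l) ->
  hdann1_layer s B q c W bias x m = hdann1_layer s B q c W' bias' x m.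
Proof.
elim: m => [|m IHm] WW' /=; apply/funext => k.
  by rewrite (WW' 1%N isT).2.
rewrite (WW' m.+2 (leqnn _)).1 (WW' m.+2 (leqnn _)).2 IHm // => l lm.
by apply: WW'; exact: leqW.
Qed.

(* The units hold the functions [F] only up to the affine maps [post k], which the
   weights of the following layer absorb. *)
Definition emulates m F : Prop := forall e : R, 0 < e ->
  exists q c W bias (post : 'I_p -> R * R), (forall j k, (1 <= q j k)%N) /\
    forall k, close_on cube e
      (fun x => aff (post k) (hdann1_layer s B q c W bias x m k)) (F k).

Lemma emulates_first F : (forall k, unit_over s coord (F k)) -> emulates 0 F.
Proof.
move=> coordF e e0.
have coord_bounded j : [bounded coord j x | x in cube].
  apply: (compact_continuous_bounded unit_cube_compact).
  exact: coord_within_continuous.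
have /choice[v /choice[post /choice[r rP]]] := fun k =>
  unit_over_robust s_lipschitz coord_bounded (coordF k) e0.
have /choice[q /choice[c /choice[c0 basis_close]]] := fun jk : 'I_d * 'I_p =>
  basis_functions_id jk.1 jk.2 (rP jk.2).1.
pose coord' k j (x : 'rV[R]_d) :=
  \sum_(1 <= i < (q (j, k)).+1) c (j, k) i * B j k i (x ord0 j) + c0 (j, k).
exists (fun j k => q (j, k)), (fun j k i => (v k).1 j * c (j, k) i),
  (fun _ _ _ => 0), (fun _ k => \sum_j (v k).1 j * c0 (j, k) + (v k).2), post.
split=> [j k|k x Cx /=]; first by have [] := basis_close (j, k).
have -> : \sum_(j < d) \sum_(1 <= i < (q (j, k)).+1)
      (v k).1 j * c (j, k) i * B j k i (x ord0 j) +
    (\sum_j (v k).1 j * c0 (j, k) + (v k).2) = affine_comb (coord' k) (v k) x.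
  rewrite /affine_comb addrA -big_split; congr (_ + _); apply: eq_bigr => j _.
  by rewrite mulrDr mulr_sumr; congr (_ + _); apply: eq_bigr => i _; rewrite mulrA.
apply: (rP k).2 => // j y Cy.
by apply: (basis_close (j, k)).2; exact: Cy.
Qed.

Lemma emulates_next m F G :
  (forall k, [bounded F k x | x in cube]) ->
  (forall k, unit_over s F (G k)) -> emulates m F -> emulates m.+1 G.
Proof.
move=> F_bounded FG emF e e0.
have /choice[v /choice[post /choice[r rP]]] := fun k =>
  unit_over_robust s_lipschitz F_bounded (FG k) e0.
have r_min : 0 < \big[Num.min/1]_k r k by apply: lt_bigmin => // k _; exact: (rP k).1.
have [q [c [W [bias [post' [q1 layer_close]]]]]] := emF _ r_min.
pose W' l k i := if l == m.+2 then (v k).1 i * (post' i).1 else W l k i.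
pose bias' l k :=
  if l == m.+2 then \sum_i (v k).1 i * (post' i).2 + (v k).2 else bias l k.
exists q, c, W', bias', post; split=> // k x Cx /=.
rewrite (@eq_hdann1_layer q c W' W bias' bias); last first.
  by move=> l lm; rewrite /W' /bias' (ltn_eqF (lm : (l < m.+2)%N)).
rewrite /W' /bias' eqxx.
pose layer i y := hdann1_layer s B q c W bias y m i.
rewrite -[X in s X]/(affine_comb layer (_, _) x) -affine_comb_aff.
apply: (rP k).2 => // i y Cy.
by rewrite (le_trans (layer_close i y Cy)) // bigmin_le.
Qed.

Lemma emulates_HDANN1 m F k (e : R) : emulates m F -> 0 < e ->
  exists q c W bias w b, (forall j i, (1 <= q j i)%N) /\
    close_on cube e (HDANN1 s B m.+1 q c W bias w b) (F k).
Proof.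
move=> emF e0; have [q [c [W [bias [post [q1 layer_close]]]]]] := emF e e0.
exists q, c, W, bias, (fun i => if i == k then (post k).1 else 0), (post k).2.
split=> // x Cx; rewrite /HDANN1 (bigD1 k) //= eqxx big1 ?addr0; last first.
  by move=> i /negPf ->; rewrite mul0r.
exact: layer_close.
Qed.

End Emulation.

Section Registers.
Context {R : realType} {d n : nat}.
Variable s : R -> R.
Hypothesis s_id : unit_computable s id.
Local Notation p := (d + n.+2)%N.
Local Notation term := (R * (('I_d -> R) * R))%type.
Implicit Types (ts : seq term) (v : term).

(* Passing from [registers ts v.2] to [registers (v :: ts) u], a layer adds to the
   partial sum the ridge term computed by the layer below. *)
Definition registers ts u (k : 'I_p) : 'rV[R]_d -> R :=
  match fintype.split k with
  | inl j => coord j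
  | inr i => nth (fun=> 0) [:: ridge s u; lincomb (ridge s) ts] i
  end.

Definition ridge_unit : 'I_p := rshift d ord0.

Definition sum_unit : 'I_p := rshift d (lift ord0 ord0).

Lemma registers_lshift ts u j : registers ts u (lshift n.+2 j) = coord j.
Proof. by rewrite /registers (unsplitK (inl j)). Qed.

Lemma registers_ridge_unit ts u : registers ts u ridge_unit = ridge s u.
Proof. by rewrite /registers (unsplitK (inr _)). Qed.

Lemma registers_sum_unit ts u : registers ts u sum_unit = lincomb (ridge s) ts.
Proof. by rewrite /registers (unsplitK (inr _)). Qed.

Lemma registers_within_continuous C ts u k : continuous s ->
  {within C, continuous (registers ts u k)}.
Proof.
move=> cs; have closedC := @continuous_closed_subspace R _ C.
rewrite /registers; case: fintype.split => [j|[[|[|i]] ?]] /=.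
- exact: coord_within_continuous.
- exact: ridge_within_continuous.
- apply: (closed_subspace_sum closedC) => v; apply: (closed_subspaceZ closedC).
  exact: ridge_within_continuous.
- by rewrite nth_nil; exact: (closed_subspace0 closedC).
Qed.

Lemma unit_over_registers (I : finType) (F : I -> 'rV[R]_d -> R) ts u k :
  (forall j, affine_span F (coord j)) -> affine_span F (lincomb (ridge s) ts) ->
  unit_over s F (registers ts u k).
Proof.
move=> Fcoord Fts; rewrite /registers; case: fintype.split => [j|[[|[|i]] ?]] /=.
- exact: unit_over_affine.
- exists s; first exact: unit_computable_self.
  by exists (affine_comb coord u) => //; exact: affine_span_comb.
- exact: unit_over_affine.
- by rewrite nth_nil; apply: unit_over_affine => //; exact: affine_span_cst.
Qed.

Lemma affine_span_lincomb_cons ts v :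
  affine_span (registers ts v.2) (lincomb (ridge s) (v :: ts)).
Proof.
have -> : lincomb (ridge s) (v :: ts) = fun x =>
    v.1 * registers ts v.2 ridge_unit x + registers ts v.2 sum_unit x.
  apply/funext => x; rewrite registers_ridge_unit registers_sum_unit.
  by rewrite /lincomb big_cons.
by apply: affine_span_lin; exact: affine_span_gen.
Qed.

Lemma emulates_registers (B : 'I_d -> 'I_p -> nat -> R -> R) ts u :
  (forall j k, basis_functions (B j k)) -> lipschitz_fun s ->
  emulates B s (size ts) (registers ts u).
Proof.
move=> B_basis sL; have cs := lipschitz_fun_continuous sL.
elim: ts u => [|v ts IHts] u.
  apply: emulates_first => // k; apply: unit_over_registers => [j|].
    exact: affine_span_gen.
  rewrite (_ : lincomb _ _ = fun=> 0) //; first exact: affine_span_cst.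
  by apply/funext => x; rewrite /lincomb big_nil.
apply: (emulates_next _ _ _ (IHts v.2)) => // k.
  apply: (compact_continuous_bounded unit_cube_compact).
  exact: registers_within_continuous.
apply: unit_over_registers; last exact: affine_span_lincomb_cons.
by move=> j; rewrite -(registers_lshift ts v.2); exact: affine_span_gen.
Qed.

End Registers.

Theorem theorem2 (R : realType) (d p : nat) (hd : (1 <= d)%N) (hp : (d + 3 <= p)%N)
  (B : 'I_d -> 'I_p -> nat -> R -> R)
  (hB : forall j k, basis_functions (B j k))
  (sigma : R -> R)
  (hs_naff : ~ affine_fun sigma)
  (hs_lip : lipschitz_fun sigma)
  (hs_C1 : C1_at_nonzero_deriv sigma)
  (f : 'rV[R]_d -> R)
  (hf : {within @unit_cube R d, continuous f})
  (eps : R) (heps : 0 < eps) :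
  exists (L : nat) (q : 'I_d -> 'I_p -> nat) (c : 'I_d -> 'I_p -> nat -> R)
         (W : nat -> 'I_p -> 'I_p -> R) (bias : nat -> 'I_p -> R)
         (w : 'I_p -> R) (b : R),
    (1 <= L)%N /\ (forall j k, (1 <= q j k)%N) /\
    (sup_dist (@unit_cube R d) f (HDANN1 sigma B L q c W bias w b) < eps%:E)%E.
Proof.
have [n pE] : exists n, p = (d + n.+2)%N by exists (p - (d + 2))%N; lia.
subst p; have [x0 [/nbhs_singleton ds [_ D0]]] := hs_C1.
have e3 : 0 < eps / 3 by rewrite divr_gt0.
have [ts f_ts] := cspan_ridge_continuous unit_cube_compact hs_lip hs_naff hf e3.
have registers_emulated := emulates_registers (n := n) (unit_computable_id ds D0)
  ts (fun=> 0, 0) hB hs_lip.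
have [q [c [W [bias [w [b [q1 ts_net]]]]]]] :=
  emulates_HDANN1 sum_unit registers_emulated e3.
exists (size ts).+1, q, c, W, bias, w, b; split=> //; split=> //.
apply: (@le_lt_trans _ _ (eps / 3 + eps / 3)%:E); last by rewrite lte_fin; lra.
apply/sup_dist_leP; apply: close_on_trans f_ts _.
by rewrite registers_sum_unit in ts_net; exact: close_on_sym.
Qed.
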